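(* Let $G$ be a connected, bounded degree, infinite graph with a fixed vertex $o$. Suppose that $G$ satisfies $\mathcal{IP}^*_\psi$ for some positive function $\psi\nearrow\infty$, and that for some $p$ there is a $\varrho=\varrho(p)<1$ such that $$\mathbb{P}_p\bigl(|\mathscr{C}_o|<\infty,\ |\partial_E^+ \mathscr{C}_o|=n\bigr)\leq \varrho^n\quad\text{for all large enough } n.$$ Then $\mathbb{P}_p$-almost surely on the event that the open cluster $\mathscr{C}_o$ is infinite, $\mathscr{C}_o$ satisfies $\mathcal{IP}^*_\psi$.
   Context: $\mathbb{P}_p$ denotes Bernoulli($p$) edge-percolation on $G$: each edge is independently open with probability $p$ and closed otherwise; $\mathscr{C}_o$ is the connected component of $o$ in the graph of open edges, regarded as a graph whose edges are its open edges. For a connected bounded degree infinite graph $H$ with a fixed vertex $o$ and a positive function $\psi$ with $\lim_{x\to\infty}\psi(x)=\infty$, $H$ satisfies the anchored $\psi$-isoperimetric inequality, denoted $\mathcal{IP}^*_\psi$, if $$0<\iota^*_\psi(H):=\lim_{n\to\infty}\inf\Bigl\{\frac{|\partial S|}{\psi(|S|)} : o\in S\subset V(H),\ S\text{ connected in } H,\ n\le|S|<\infty\Bigr\},$$ where $\partial S$ is the edge boundary in $H$ (edges of $H$ with exactly one endpoint in $S$); because of bounded degrees a vertex boundary can equally be used, and the property does not depend on the choice of $o$. Notation $\psi\nearrow\infty$ means that $\psi$ is monotone increasing and tends to infinity. For a finite connected vertex set $S$ of $G$, the closure $\overline{S}$ is the union of $S$ with all finite connected components of $G\setminus S$, and the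 edge frontier $\partial_E^+S:=\partial_E\overline{S}$ is the set of edges of $G$ with exactly one endpoint in $\overline{S}$. *)

(* Defs.v *)
From HB Require Import structures.
From Stdlib Require Import Relation_Operators.
From mathcomp Require Import all_boot all_order all_algebra finmap.
From mathcomp Require Import all_classical all_reals all_analysis.
Set Implicit Arguments.
Unset Strict Implicit.
Unset Printing Implicit Defensive.
Import Order.TTheory GRing.Theory Num.Theory.
Import numFieldNormedType.Exports.
Local Open Scope classical_set_scope.
Local Open Scope ring_scope.

(* Simple graphs whose vertices form a subset of the ambient type V, so that
   subgraphs of a graph (open clusters in particular) live on the same type. *)
Record sgraph (V : Type) := SGraph {
  verts : set V;
  adj : V -> V -> Prop;
  adj_sym : forall x y, adj x y -> adj y x;
  adj_irr : forall x, ~ adj x x;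
  adj_verts : forall x y, adj x y -> verts x
}.

(* The cardinality of a finite set; the value on infinite sets is 0. *)
Definition set_card {T : choiceType} (A : set T) : nat := #|` fset_set A|%fset.

Section Graphs.
Variable V : choiceType.
Implicit Types (H : sgraph V) (S : set V).

(* An edge is the unordered pair of its endpoints, as a two-element set. *)
Definition edges H : set (set V) :=
  [set e | exists x y, adj H x y /\ e = [set x; y]].

(* Reachability is reflexive at every point of V: [component H x] is
   meaningful for x in [verts H]. *)
Definition reachable H : V -> V -> Prop := clos_refl_trans V (adj H).

Definition component H (x : V) : set V := [set y | reachable H x y].

Definition connected_graph H : Prop :=
  forall x y, verts H x -> verts H y -> reachable H x y.

Definition infinite_graph H : Prop := ~ finite_set (verts H).

Definition bounded_degree H : Prop :=
  exists D : nat, forall x, verts H x -> ([set y | adj H x y] #<= `I_D)%card.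

Lemma induced_sym H S x y :
  adj H x y /\ S x /\ S y -> adj H y x /\ S y /\ S x.
Proof. by move=> [xy [Sx Sy]]; split; first exact: adj_sym. Qed.

Lemma induced_irr H S x : ~ (adj H x x /\ S x /\ S x).
Proof. by move=> [xx _]; exact: (adj_irr xx). Qed.

Lemma induced_verts H S x y :
  adj H x y /\ S x /\ S y -> (verts H `&` S) x.
Proof. by move=> [xy [Sx _]]; split=> //; exact: (adj_verts xy). Qed.

Definition induced_subgraph H S : sgraph V :=
  SGraph (@induced_sym H S) (@induced_irr H S) (@induced_verts H S).

Definition connected_in H S : Prop :=
  S `<=` verts H /\ connected_graph (induced_subgraph H S).

Definition edge_boundary H S : set (set V) :=
  [set e | exists x y, [/\ adj H x y, S x, ~ S y & e = [set x; y]]].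

Definition filled_closure H S : set V :=
  S `|` [set x | (verts H `\` S) x /\
                 finite_set (component (induced_subgraph H (verts H `\` S)) x)].

Definition edge_frontier H S : set (set V) := edge_boundary H (filled_closure H S).

Definition anchored_sets H (o : V) (n : nat) : set (set V) :=
  [set S | [/\ S o, connected_in H S, finite_set S & (n <= set_card S)%N]].

(* The constant takes values in [0, +oo] when psi is positive; the infima
   increase with n, so that the limit exists. *)
Definition anchored_constant (R : realType) H (o : V) (psi : R -> R) : \bar R :=
  limn (fun n : nat => ereal_inf
    [set ((set_card (edge_boundary H S))%:R / psi (set_card S)%:R)%:E
       | S in anchored_sets H o n]).

Definition anchored_IP (R : realType) H (o : V) (psi : R -> R) : Prop :=
  (0 < anchored_constant H o psi)%E.

(* w is the set of open edges; only edges of H are retained. *)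
Section Open.
Variables (H : sgraph V) (w : set (set V)).

Let open_adj x y := adj H x y /\ w [set x; y].

Lemma open_sym x y : open_adj x y -> open_adj y x.
Proof. by move=> [xy wxy]; split; [exact: adj_sym|rewrite setUC]. Qed.

Lemma open_irr x : ~ open_adj x x.
Proof. by move=> [xx _]; exact: (adj_irr xx). Qed.

Lemma open_verts x y : open_adj x y -> verts H x.
Proof. by move=> [xy _]; exact: (adj_verts xy). Qed.

Definition open_graph : sgraph V := SGraph open_sym open_irr open_verts.

Definition open_cluster (o : V) : sgraph V :=
  induced_subgraph open_graph (component open_graph o).

End Open.

End Graphs.

Definition mutually_independent (R : realType) (d : measure_display)
    (T : measurableType d) (P : probability T R) (I : choiceType)
    (D : set I) (A : I -> set T) : Prop :=
  forall J : {fset I}, [set` J] `<=` D ->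
    P (\bigcap_(i in [set` J]) A i) = (\prod_(i <- J) P (A i))%E.

(* w is a random set of open edges, defined on some probability space, whose
   law is the product Bernoulli(p) measure on the edges of G. *)
Definition bernoulli_percolation (R : realType) (V : choiceType)
    (G : sgraph V) (p : R) (d : measure_display) (T : measurableType d)
    (P : probability T R) (w : T -> set (set V)) : Prop :=
  let is_open e := [set t | w t e] in
  [/\ forall e, edges G e -> measurable (is_open e),
      forall e, edges G e -> P (is_open e) = p%:E &
      mutually_independent P (edges G) is_open].

(* Main.v *)
(* Let S be a finite set containing o and connected by open edges, K its filled
   closure and F the edge boundary of K. That K arises from such an S depends
   only on the edges inside K, hence is independent of the states of the edges
   in F. If moreover F is entirely closed, then the cluster of o is finite with
   filled closure K; these events are therefore disjoint for distinct K, and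
   for |F| = n the hypothesis bounds the sum of their probabilities by rho^n.
   Replacing "F is closed" by "at most n/k edges of F are open" multiplies the
   probability by at most theta^n, where theta is as close to 1 as we wish when
   k is large (Chernoff). Summing over K and applying Borel-Cantelli, almost
   surely only finitely many n admit such a K with at most n/k open edges in F;
   for the others, the open part of F lies in the boundary of S in the cluster
   and n = |F| >= c psi(|K|) >= c psi(|S|). *)
Require Import Defs.
From Stdlib Require Import Relation_Operators Operators_Properties.
From mathcomp Require Import all_boot all_order all_algebra finmap.
From mathcomp Require Import all_classical all_reals all_analysis.
From mathcomp Require Import ring lra.
Set Implicit Arguments.
Unset Strict Implicit.
Unset Printing Implicit Defensive.
Import Order.TTheory GRing.Theory Num.Theory.
Import numFieldNormedType.Exports.
Local Open Scope classical_set_scope.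
Local Open Scope ring_scope.

(** * Filled closures and open clusters *)

Local Arguments clos_rt_rtn1 {A R x y}.
Local Arguments clos_rtn1_rt {A R x y}.
Local Arguments clos_rt_rt1n {A R x y}.

Lemma clos_rt_mono (A : Type) (r r' : A -> A -> Prop) :
  (forall x y, r x y -> r' x y) ->
  forall x y, clos_refl_trans A r x y -> clos_refl_trans A r' x y.
Proof.
move=> rr' x y; elim=> [a b /rr'|a|a b c _ ab _ bc].
- exact: rt_step.
- exact: rt_refl.
- exact: rt_trans ab bc.
Qed.

Section Graphs.
Variables (V : choiceType) (H : sgraph V).
Implicit Types (S K : set V) (x y o : V).

Definition locally_finite : Prop := forall x, finite_set [set y | adj H x y].

Lemma bounded_degree_locally_finite : bounded_degree H -> locally_finite.
Proof.
move=> [D degD] x; have [Hx|nHx] := pselect (verts H x).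
  exact: card_le_finite (degD x Hx) (finite_II D).
apply: sub_finite_set (finite_set0 V) => y xy.
by case: nHx; exact: adj_verts xy.
Qed.

Lemma reachable_sym x y : reachable H x y -> reachable H y x.
Proof.
elim=> [a b ab|a|a b c _ ba _ cb]; [|exact: rt_refl|exact: rt_trans cb ba].
by apply: rt_step; exact: adj_sym.
Qed.

Lemma reachable_verts x y : reachable H x y -> verts H x -> verts H y.
Proof.
by elim=> [a b ab _|//|a b c _ ab _ bc /ab /bc //]; exact: adj_verts (adj_sym ab).
Qed.

Lemma component_connected o x :
  reachable H o x -> reachable (induced_subgraph H (component H o)) o x.
Proof.
move/clos_rt_rtn1; elim=> [|y z yz /clos_rtn1_rt oy IH]; first exact: rt_refl.
apply: rt_trans IH (rt_step _ _ _ _ _); split => //; split; first exact: oy.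
exact: rt_trans oy (rt_step _ _ _ _ yz).
Qed.

End Graphs.

Lemma connected_to_center (V : choiceType) (H : sgraph V) (S : set V) (o : V) :
  S `<=` verts H -> S o ->
  (forall x, S x -> reachable (induced_subgraph H S) x o) -> connected_in H S.
Proof.
move=> SH So to_o; split=> // x y [_ Sx] [_ Sy].
apply: rt_trans (to_o _ Sx) _.
by apply: reachable_sym; exact: to_o.
Qed.

Section FilledClosure.
Variables (V : choiceType) (H : sgraph V).
Implicit Types (S K : set V) (x y o : V).

Lemma sub_filled_closure S : S `<=` filled_closure H S.
Proof. by left. Qed.

Lemma filled_closure_verts S :
  S `<=` verts H -> filled_closure H S `<=` verts H.
Proof. by move=> SH x [/SH //|[[]]]. Qed.

(** Both points lie outside [S] and are adjacent, so they share a component of the complement of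
    [S], and that component is finite. *)
Lemma filled_closure_adj S x y : adj H x y ->
  filled_closure H S x -> ~ S x -> ~ S y -> filled_closure H S y.
Proof.
move=> xy [//|[[Hx _] fin_x]] nSx nSy.
have Hy := adj_verts (adj_sym xy); right; split=> //.
apply: sub_finite_set fin_x => z; apply: rt_trans.
exact: rt_step.
Qed.

(** Frontier edges start in [S] itself: a finite component of the complement that has been filled in
    has no edge leading out of the closure. This is what turns open frontier edges into boundary
    edges of [S]. *)
Lemma frontier_inner_endpoint S x y : adj H x y ->
  filled_closure H S x -> ~ filled_closure H S y -> S x /\ ~ S y.
Proof.
move=> xy Kx nKy; have nSy : ~ S y by move/sub_filled_closure.
by split=> //; apply: contrapT => nSx; apply: nKy; exact: filled_closure_adj Kx _ _.
Qed.

(** Follow a path of [H] from a point of the closure to [o]. Until it first meets [S] it stays in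
    the closure, and from there on the connectedness of [S] takes over. *)
Lemma filled_closure_connected S o : connected_graph H -> S o ->
  connected_in H S -> connected_in H (filled_closure H S).
Proof.
move=> conH So [SH conS]; have KH := filled_closure_verts SH.
apply: (connected_to_center (o := o)) => //; first exact: sub_filled_closure.
move=> x Kx; have /clos_rt_rt1n : reachable H x o by apply: conH; auto.
move=> xo; elim: xo So Kx => [*|{}x y {}o xy _ IH So Kx]; first exact: rt_refl.
have [Sx|nSx] := pselect (S x).
  have := conS x o (conj (SH _ Sx) Sx) (conj (SH _ So) So).
  apply: clos_rt_mono => a b [ab [Sa Sb]].
  by do !split=> //; exact: sub_filled_closure.
have Ky : filled_closure H S y.
  have [/sub_filled_closure//|] := pselect (S y).
  exact: filled_closure_adj xy Kx nSx.
by apply: rt_trans (rt_step _ _ _ _ _) (IH So Ky).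
Qed.

(** Since [H] is connected, every filled component contains a neighbour of [S]. Local finiteness
    leaves only finitely many such neighbours, hence finitely many filled components, each of them
    finite. *)
Lemma filled_closure_finite S o : connected_graph H -> locally_finite H ->
  S o -> S `<=` verts H -> finite_set S -> finite_set (filled_closure H S).
Proof.
move=> conH lfH So SH finS.
pose C := component (induced_subgraph H (verts H `\` S)).
pose N := [set y | finite_set (C y)] `&` \bigcup_(s in S) [set y | adj H s y].
have finN : finite_set N by apply: finite_setIr; apply: bigcup_finite.
have : finite_set (S `|` \bigcup_(y in N) C y).
  by rewrite finite_setU; split=> //; apply: bigcup_finite => // y [].
apply: sub_finite_set => x Kx; have [Sx|nSx] := pselect (S x); [by left|right].
have Hx := filled_closure_verts SH Kx.
have /clos_rt_rt1n : reachable H x o by apply: conH; auto.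
move=> xo; elim: xo So Kx nSx Hx => [//|{}x y {}o xy _ IH] So Kx nSx Hx.
have [Sy|nSy] := pselect (S y).
  exists x; last exact: rt_refl.
  by case: Kx => [//|[_ finx]]; split=> //; exists y => //; exact: adj_sym.
have Ky := filled_closure_adj xy Kx nSx nSy.
have Hy := adj_verts (adj_sym xy).
have [z Nz Czy] := IH So Ky nSy Hy; exists z => //.
by apply: rt_trans Czy (rt_step _ _ _ _ _); do !split=> //; exact: adj_sym.
Qed.

(** This identifies the filled closure of a cluster caught between an open connected set and its
    closure. For one inclusion, enlarging [S] to [S'] only shrinks the components of the
    complement. *)
Lemma filled_closure_sandwich S S' :
  S `<=` S' -> S' `<=` filled_closure H S ->
  filled_closure H S' = filled_closure H S.
Proof.
move=> SS' S'K; apply/seteqP; split=> x; last first.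
  case=> [Sx|[[Hx nSx] finx]]; first by left; exact: SS'.
  have [S'x|nS'x] := pselect (S' x); [by left|right; split=> //].
  apply: sub_finite_set finx => y.
  apply: clos_rt_mono => a b [ab [[Ha na] [Hb nb]]].
  by do !split=> //; move/SS'.
case=> [/S'K//|[[Hx nS'x] finx]]; apply: contrapT => nKx.
have nSx : ~ S x by move/SS'.
(* If the component of [x] off [S] met the closure, it would be finite and [x] would lie in the
   closure. So it avoids the closure, hence [S'], and is contained in the component off [S'], which
   is finite. *)
have avoidK y : reachable (induced_subgraph H (verts H `\` S)) x y ->
    ~ filled_closure H S y.
  move=> xy Ky; apply: nKx; right; split=> //.
  have [_ [_ nSy]] : verts (induced_subgraph H (verts H `\` S)) y.
    by apply: reachable_verts xy _.
  case: Ky => [//|[_]]; apply: sub_finite_set => z xz.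
  exact: rt_trans (reachable_sym xy) xz.
apply: (nKx); right; split=> //; apply: sub_finite_set finx => y.
move/clos_rt_rtn1; elim=> [|a b ab /clos_rtn1_rt xa IH]; first exact: rt_refl.
apply: rt_trans IH (rt_step _ _ _ _ _); case: (ab) => [Hab [[Ha _] [Hb _]]].
do !split=> //; move/S'K; apply: avoidK => //.
exact: rt_trans xa (rt_step _ _ _ _ ab).
Qed.

Lemma edge_boundary_finite S :
  locally_finite H -> finite_set S -> finite_set (edge_boundary H S).
Proof.
move=> lfH finS.
pose N := \bigcup_(s in S) [set y | adj H s y].
have finN : finite_set N by apply: bigcup_finite.
apply: sub_finite_set (finite_image2 (fun x y => [set x; y]) finS finN).
by move=> _ [x [y [xy Sx _ ->]]]; exists x => //; exists y => //; exists x.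
Qed.

Definition inner_edges S : set (set V) :=
  [set e | exists x y, [/\ adj H x y, S x, S y & e = [set x; y]]].

Lemma inner_edges_finite S : finite_set S -> finite_set (inner_edges S).
Proof.
move=> finS; apply: sub_finite_set (finite_image2 (fun x y => [set x; y]) finS finS).
by move=> _ [x [y [_ Sx Sy ->]]]; exists x => //; exists y.
Qed.

Lemma inner_edges_boundary_disjoint S : inner_edges S `&` edge_boundary H S = set0.
Proof.
apply/seteqP; split=> // e [[x [y [_ Sx Sy ->]]] [a [b [_ _ nSb exy]]]].
have : [set a; b] b by right.
by rewrite -exy => -[] bE; apply: nSb; rewrite bE.
Qed.

Lemma inner_edges_edges S : inner_edges S `<=` edges H.
Proof. by move=> _ [x [y [xy _ _ ->]]]; exists x, y. Qed.

Lemma edge_boundary_edges S : edge_boundary H S `<=` edges H.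
Proof. by move=> _ [x [y [xy _ _ ->]]]; exists x, y. Qed.

(** * Balls, and finiteness of the collection of small connected sets *)

Fixpoint ball o r : set V :=
  if r is r'.+1 then ball o r' `|` \bigcup_(x in ball o r') [set y | adj H x y]
  else [set o].

Lemma ball_finite o r : locally_finite H -> finite_set (ball o r).
Proof.
move=> lfH; elim: r => [|r IH] /=; first exact: finite_set1.
by rewrite finite_setU; split=> //; apply: bigcup_finite.
Qed.

Lemma ball_path (e : rel V) o r x s : (forall y z, e y z -> adj H y z) ->
  ball o r x -> path e x s -> ball o (r + size s)%N (last x s).
Proof.
move=> eH; elim: s r x => [|y s IH] r x /=; first by rewrite addn0.
move=> Bx /andP[/eH xy ps]; rewrite addnS -addSn; apply: IH => //.
by right; exists x.
Qed.

Lemma ball_mono o r r' : (r <= r')%N -> ball o r `<=` ball o r'.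
Proof.
move=> /subnK<-; elim: (r' - r)%N => [|m IH] //= x Bx.
by left; rewrite -/addn; exact: IH.
Qed.

(* A simple path inside K has at most #|K| vertices. *)
Lemma connected_sub_ball K o : K o -> connected_in H K -> finite_set K ->
  K `<=` ball o (set_card K).
Proof.
move=> Ko [KH conK] finK x Kx.
have := conK o x (conj (KH _ Ko) Ko) (conj (KH _ Kx) Kx).
pose e : rel V := fun a b => `[< adj H a b /\ K a /\ K b >].
have eK a b : e a b -> K b by move=> /asboolP[_ []].
move=> /clos_rt_rt1n ox.
have [s ps xE] : exists2 s, path e o s & x = last o s.
  elim: ox => [a|a b c /asboolP ab _ [s bs ->]]; first by exists [::].
  by exists (b :: s) => //=; apply/andP; split.
rewrite {}xE {ox}; case/shortenP: ps => s' ps' us' _.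
have sK : {subset s' <= fset_set K}.
  elim: s' o Ko ps' {us'} => // b s' IH a Ka /= /andP[/eK Kb bs'] z.
  rewrite inE => /orP[/eqP->|]; first by rewrite in_fset_set// inE.
  exact: IH Kb bs' z.
apply: (@ball_mono _ (0 + size s')%N).
  by apply: uniq_leq_size sK; case/andP: us'.
by apply: (ball_path _ _ ps') => // a b /asboolP[].
Qed.

Lemma finite_powerset (T : choiceType) (A : set T) : finite_set A ->
  finite_set [set B | B `<=` A].
Proof.
move=> finA; apply: sub_finite_set
  (finite_image (fun X : {fset T} => [set` X]) (finite_fset (fpowerset (fset_set A)))).
move=> B /= BA; have finB := sub_finite_set BA finA.
exists (fset_set B); last by rewrite fset_setK.
rewrite /= fpowersetE; apply/fsubsetP => x.
by rewrite !in_fset_set// !inE => /BA.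
Qed.

(** Such sets all lie in the ball of radius [n] around [o], which is finite and so has finitely many
    subsets. *)
Lemma finite_connected_sets o n : locally_finite H ->
  finite_set [set K | [/\ K o, connected_in H K, finite_set K
                       & (set_card K <= n)%N]].
Proof.
move=> lfH; apply: sub_finite_set (finite_powerset (ball_finite o n lfH)).
move=> K [Ko conK finK Kn]; move=> x Kx; apply: (ball_mono Kn).
exact: connected_sub_ball Kx.
Qed.

Lemma connected_in_sub (H' : sgraph V) S : verts H' `<=` verts H ->
  (forall x y, adj H' x y -> S x -> S y -> adj H x y) ->
  connected_in H' S -> connected_in H S.
Proof.
move=> H'H adjS [SH' conS]; split=> [x /SH' /H'H //|x y [_ Sx] [_ Sy]].
have := conS x y (conj (SH' _ Sx) Sx) (conj (SH' _ Sy) Sy).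
by apply: clos_rt_mono => a b [ab [Sa Sb]]; do !split=> //; exact: adjS.
Qed.

End FilledClosure.

Section OpenCluster.
Variables (V : choiceType) (G : sgraph V) (w : set (set V)) (o : V).
Hypothesis Go : verts G o.
Implicit Types S K : set V.

Local Notation C := (verts (open_cluster G w o)).

Lemma cluster_verts : C `<=` verts G.
Proof. by move=> x []. Qed.

Lemma cluster_center : C o.
Proof. by split=> //; exact: rt_refl. Qed.

Lemma cluster_adj x y : C x -> adj G x y -> w [set x; y] -> C y.
Proof.
move=> [_ ox] xy wxy; split; first exact: adj_verts (adj_sym xy).
by apply: rt_trans ox (rt_step _ _ _ _ _).
Qed.

Lemma cluster_connected : connected_in (open_graph G w) C.
Proof.
apply: (connected_to_center (o := o)) => //; first exact: cluster_verts.
  exact: cluster_center.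
move=> x [_ ox]; apply: reachable_sym.
move/component_connected: ox; apply: clos_rt_mono => a b [[ab wab] [oa ob]].
have Ga := adj_verts ab; have Gb := adj_verts (adj_sym ab).
by do !split.
Qed.

Lemma open_connected_sub_cluster S :
  S o -> connected_in (open_graph G w) S -> S `<=` C.
Proof.
move=> So [SG conS] x Sx; split; first exact: SG.
have := conS o x (conj (SG _ So) So) (conj (SG _ Sx) Sx).
by apply: clos_rt_mono => a b [].
Qed.

Lemma open_connected_in S :
  connected_in (open_graph G w) S -> connected_in G S.
Proof. by apply: connected_in_sub => // x y []. Qed.

Lemma cluster_connected_open S :
  connected_in (open_cluster G w o) S -> connected_in (open_graph G w) S.
Proof. by apply: connected_in_sub => [x []//|x y []]. Qed.

Lemma frontier_cluster_closed e : edge_frontier G C e -> ~ w e.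
Proof.
move=> [x [y [xy Kx nKy ->]]] wxy.
have [Cx nCy] := frontier_inner_endpoint xy Kx nKy.
by apply: nCy; exact: cluster_adj Cx xy wxy.
Qed.

Lemma cluster_sub_closed_boundary K : K o ->
  (forall e, edge_boundary G K e -> ~ w e) -> C `<=` K.
Proof.
move=> Ko closedK x [_ /clos_rt_rtn1]; elim=> // a b [ab wab] _ Ka.
apply: contrapT => nKb; apply: (closedK [set a; b]) => //.
by exists a, b.
Qed.

(** An open frontier edge starts in [S], hence in the cluster, and being open it also ends in the
    cluster. *)
Lemma open_frontier_sub_boundary S : S `<=` C ->
  edge_frontier G S `&` w `<=` edge_boundary (open_cluster G w o) S.
Proof.
move=> SC e [[x [y [xy Kx nKy ->]]] wxy].
have [Sx nSy] := frontier_inner_endpoint xy Kx nKy.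
have [Gx ox] := SC _ Sx; have [Gy oy] := cluster_adj (SC _ Sx) xy wxy.
by exists x, y; split.
Qed.

End OpenCluster.

Lemma connected_in_open_graph_eq (V : choiceType) (G : sgraph V)
    (w w' : set (set V)) (S : set V) :
  (forall e, inner_edges G S e -> w e -> w' e) ->
  connected_in (open_graph G w) S -> connected_in (open_graph G w') S.
Proof.
move=> ww'; apply: connected_in_sub => // x y [xy wxy] Sx Sy; split=> //.
by apply: ww' => //; exists x, y.
Qed.

(** * Independent Bernoulli trials *)

Section BernoulliMean.
Variables (R : realType) (p : R) (I : eqType).
Implicit Types (s : seq I) (f g : seq I -> R).

(* Expectation of f at the list of the successful indices of s in independent
   Bernoulli(p) trials. *)
Fixpoint bernoulli_mean s f : R :=
  if s is i :: s' then
    p * bernoulli_mean s' (fun b => f (i :: b)) + (1 - p) * bernoulli_mean s' f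
  else f [::].

Lemma bernoulli_mean_cat s s' f :
  bernoulli_mean (s ++ s') f =
  bernoulli_mean s (fun b => bernoulli_mean s' (fun b' => f (b ++ b'))).
Proof. by elim: s f => [|i s IH] f //=; rewrite !IH. Qed.

Lemma bernoulli_meanZr s f c :
  bernoulli_mean s (fun b => f b * c) = bernoulli_mean s f * c.
Proof. by elim: s f => [|i s IH] f //=; rewrite !IH; ring. Qed.

Lemma bernoulli_meanZl s f c :
  bernoulli_mean s (fun b => c * f b) = c * bernoulli_mean s f.
Proof. by elim: s f => [|i s IH] f //=; rewrite !IH; ring. Qed.

(** The generating function of the number of successes: each trial contributes one factor. *)
Lemma bernoulli_mean_expr s c :
  bernoulli_mean s (fun b => c ^+ size b) = (p * c + (1 - p)) ^+ size s.
Proof.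
elim: s => [|i s IH] //=; rewrite [RHS]exprS -IH.
rewrite [RHS]mulrDl -mulrA -(bernoulli_meanZl _ _ c).
by under eq_fun do rewrite exprS.
Qed.

Lemma bernoulli_mean_none s :
  bernoulli_mean s (fun b => (size b == 0)%:R) = (1 - p) ^+ size s.
Proof.
(* Since [0 ^+ 0 = 1], the generating function at 0 is the mean of the indicator of no success. *)
have := bernoulli_mean_expr s 0; rewrite mulr0 add0r => <-.
by under [in RHS]eq_fun do rewrite expr0n.
Qed.

Hypothesis p01 : 0 <= p <= 1.

Lemma le_bernoulli_mean s f g : (forall b, subseq b s -> f b <= g b) ->
  bernoulli_mean s f <= bernoulli_mean s g.
Proof.
have /andP[p0 p1] := p01.
elim: s f g => [|i s IH] f g fg /=; first exact: fg.
apply: lerD; apply: ler_wpM2l => //; rewrite ?subr_ge0//; apply: IH => b bs.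
  by apply: fg; rewrite /= eqxx.
by apply: fg; exact: subseq_trans bs (subseq_cons _ _).
Qed.

Lemma eq_bernoulli_mean s f g : (forall b, subseq b s -> f b = g b) ->
  bernoulli_mean s f = bernoulli_mean s g.
Proof.
by move=> fg; apply/eqP; rewrite eq_le !le_bernoulli_mean// => b /fg ->.
Qed.

Lemma bernoulli_mean_ge0 s f : (forall b, 0 <= f b) -> 0 <= bernoulli_mean s f.
Proof.
move=> f0; have := @bernoulli_meanZr s f 0; rewrite mulr0 => <-.
by apply: le_bernoulli_mean => b _; rewrite mulr0.
Qed.

(** Exponential Markov inequality for the lower tail: as [u <= 1], the indicator is at most
    [u ^- n * u ^+ (k * size b)], whose mean is given by the generating function at [u ^+ k]. *)
Lemma bernoulli_mean_chernoff s k n u : 0 < u <= 1 ->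
  bernoulli_mean s (fun b => (k * size b <= n)%N%:R) <=
    u ^- n * (p * u ^+ k + (1 - p)) ^+ size s.
Proof.
move=> /andP[u0 u1]; rewrite -bernoulli_mean_expr -bernoulli_meanZl.
apply: le_bernoulli_mean => b _; rewrite -exprM.
rewrite ler_pdivlMl ?exprn_gt0//; case: leqP => [kn|_]; last first.
  by rewrite mulr0 exprn_ge0// ltW.
by rewrite mulr1; apply: ler_wiXn2l => //; exact: ltW.
Qed.

End BernoulliMean.

Lemma bernoulli_mean_all (R : realType) (I : eqType) (s : seq I) f :
  bernoulli_mean (1 : R) s f = f s.
Proof.
by elim: s f => [|i s IH] f //=; rewrite subrr mul0r addr0 mul1r IH.
Qed.

Section BernoulliLaw.
Context (R : realType) (d : measure_display) (T : measurableType d).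
Variables (P : probability T R) (I : choiceType) (D : set I) (A : I -> set T).
Variable p : R.
Hypothesis measA : forall i, D i -> measurable (A i).
Hypothesis probA : forall i, D i -> P (A i) = p%:E.
Hypothesis p01 : 0 <= p <= 1.
Hypothesis indepA : mutually_independent P D A.

Definition successes (s : seq I) (t : T) : seq I := [seq i <- s | `[< A i t >]].

Definition cylinder (a c : seq I) : set T :=
  [set t | (forall i, i \in a -> A i t) /\ (forall i, i \in c -> ~ A i t)].

Lemma cylinder_cons a c i :
  cylinder a c = cylinder (i :: a) c `|` cylinder a (i :: c) /\
  cylinder (i :: a) c `&` cylinder a (i :: c) = set0.
Proof.
split; last first.
  apply/seteqP; split=> // t [[ia _] [_ ic]].
  by apply: (ic i); [|apply: ia]; rewrite inE eqxx.
apply/seteqP; split=> [t [ta tc]|t [|] [ta tc]].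
- have [Ait|nAit] := pselect (A i t); [left|right]; split=> // j.
    by rewrite inE => /orP[/eqP->|/ta].
  by rewrite inE => /orP[/eqP->|/tc].
- by split=> // j ja; apply: ta; rewrite inE ja orbT.
- by split=> // j jc; apply: tc; rewrite inE jc orbT.
Qed.

(** Independence is assumed for successes only, which is the case of empty [c]. Failures are added
    one at a time, by subtracting from a cylinder the part where the new trial succeeds. *)
Lemma cylinder_prob a c : uniq (a ++ c) -> (forall i, i \in a ++ c -> D i) ->
  measurable (cylinder a c) /\
  P (cylinder a c) = (p ^+ size a * (1 - p) ^+ size c)%:E.
Proof.
elim: c a => [|i c IH] a.
  rewrite cats0 => ua aD.
  have -> : cylinder a [::] = \bigcap_(i in [set` [fset i in a]%fset]) A i.
    by apply/seteqP; split=> [t [ta _] i /=|t ta];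
      [rewrite inE; exact: ta|split=> // i ia; apply: ta; rewrite /= inE].
  split.
    by apply: fin_bigcap_measurable => // i /=; rewrite inE => /aD/measA.
  rewrite indepA; last by move=> i /=; rewrite inE => /aD.
  rewrite big_seq (eq_bigr (fun=> p%:E)); last first.
    by move=> i; rewrite inE => /aD/probA.
  rewrite -big_seq prodEFin big_const_seq count_predT card_fseq undup_id//.
  by rewrite -Monoid.iteropE mulr1.
move=> uac acD.
have perm : perm_eq (a ++ i :: c) (i :: a ++ c) by rewrite -cat1s perm_catCA.
have [mac Pac] : measurable (cylinder a c) /\
    P (cylinder a c) = (p ^+ size a * (1 - p) ^+ size c)%:E.
  apply: IH; first by move: uac; rewrite (perm_uniq perm) /= => /andP[].
  by move=> j jac; apply: acD; rewrite (perm_mem perm) inE jac orbT.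
have [mia Pia] : measurable (cylinder (i :: a) c) /\
    P (cylinder (i :: a) c) = (p ^+ (size a).+1 * (1 - p) ^+ size c)%:E.
  apply: (IH (i :: a)); first by move: uac; rewrite (perm_uniq perm).
  by move=> j jac; apply: acD; rewrite (perm_mem perm).
have [E E0] := cylinder_cons a c i.
have -> : cylinder a (i :: c) = cylinder a c `\` cylinder (i :: a) c.
  rewrite E setDUl setDv set0U; apply/esym/setDidPl.
  by rewrite setIC.
split; first exact: measurableD.
have Pfin : (P (cylinder a c) < +oo)%E by rewrite Pac ltry.
have -> : P (cylinder a c `\` cylinder (i :: a) c) =
    (P (cylinder a c) - P (cylinder a c `&` cylinder (i :: a) c))%E.
  exact: measureD.
rewrite setIidr; last by rewrite E; left.
by rewrite Pac Pia -EFinB; congr EFin; rewrite /= !exprS; ring.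
Qed.

(** The cylinder makes the induction on [s] go through: the first trial is conditioned on and moves
    into [a] if it succeeds and into [c] if it fails, matching the recursion of [bernoulli_mean]. *)
Lemma successes_cylinder_prob s (Q : seq I -> Prop) a c :
  uniq (s ++ a ++ c) -> (forall i, i \in s ++ a ++ c -> D i) ->
  measurable ([set t | Q (successes s t)] `&` cylinder a c) /\
  P ([set t | Q (successes s t)] `&` cylinder a c) =
    (bernoulli_mean p s (fun b => `[< Q b >]%:R)
       * (p ^+ size a * (1 - p) ^+ size c))%:E.
Proof.
elim: s Q a c => [|i s IH] Q a c.
  move=> uac acD; rewrite /successes /=; case: asboolP => q.
    rewrite [X in X `&` _](_ : _ = setT) ?setTI; last by apply/seteqP; split.
    by rewrite mul1r; exact: cylinder_prob.
  rewrite [X in X `&` _](_ : _ = set0) ?set0I ?measure0 ?mul0r//.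
  by apply/seteqP; split.
move=> uac acD.
have perm1 : perm_eq ((i :: s) ++ a ++ c) (s ++ (i :: a) ++ c).
  by rewrite -cat1s -catA perm_catCA.
have perm2 : perm_eq ((i :: s) ++ a ++ c) (s ++ a ++ i :: c).
  by rewrite (permPl perm1) perm_cat2l -[i :: c]cat1s perm_sym perm_catCA.
have [m1 P1] : measurable ([set t | Q (i :: successes s t)] `&` cylinder (i :: a) c) /\
    P ([set t | Q (i :: successes s t)] `&` cylinder (i :: a) c) =
    (bernoulli_mean p s (fun b => `[< Q (i :: b) >]%:R)
       * (p ^+ (size a).+1 * (1 - p) ^+ size c))%:E.
  apply: (IH (fun b => Q (i :: b)) (i :: a) c); first by rewrite -(perm_uniq perm1).
  by move=> j; rewrite -(perm_mem perm1); exact: acD.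
have [m2 P2] : measurable ([set t | Q (successes s t)] `&` cylinder a (i :: c)) /\
    P ([set t | Q (successes s t)] `&` cylinder a (i :: c)) =
    (bernoulli_mean p s (fun b => `[< Q b >]%:R)
       * (p ^+ size a * (1 - p) ^+ (size c).+1))%:E.
  apply: (IH Q a (i :: c)); first by rewrite -(perm_uniq perm2).
  by move=> j; rewrite -(perm_mem perm2); exact: acD.
have [E E0] := cylinder_cons a c i.
have -> : [set t | Q (successes (i :: s) t)] `&` cylinder a c =
  ([set t | Q (i :: successes s t)] `&` cylinder (i :: a) c) `|`
  ([set t | Q (successes s t)] `&` cylinder a (i :: c)).
  rewrite E setIUr; congr (_ `|` _); apply/seteqP; rewrite /successes /=.
    by split=> t /= [+ tc]; have /asboolT -> : A i t by
      (apply: tc.1; rewrite inE eqxx).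
  by split=> t /= [+ tc]; have /asboolF -> : ~ A i t by
      (apply: tc.2; rewrite inE eqxx).
split; first exact: measurableU.
rewrite [LHS]measureU//; last by rewrite setIACA E0 setI0.
by rewrite [X in (X + _)%E]P1 [X in (_ + X)%E]P2 -EFinD; congr EFin; rewrite /= !exprS; ring.
Qed.

Lemma successes_prob s (Q : seq I -> Prop) :
  uniq s -> (forall i, i \in s -> D i) ->
  measurable [set t | Q (successes s t)] /\
  P [set t | Q (successes s t)] = (bernoulli_mean p s (fun b => `[< Q b >]%:R))%:E.
Proof.
move=> us sD; have := @successes_cylinder_prob s Q [::] [::].
rewrite !cats0 => /(_ us sD); rewrite (_ : cylinder _ _ = setT); last by apply/seteqP; split.
by rewrite setIT !expr0 !mulr1.
Qed.

(** Independence of events that depend on disjoint blocks of trials. The blocks are concatenated,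
    and each one's successes are recovered from the joint list by filtering, which disjointness
    permits. *)
Lemma successes_block_prob s s' (Q Q' : seq I -> Prop) :
  uniq (s ++ s') -> (forall i, i \in s ++ s' -> D i) ->
  let B := [set t | Q (successes s t) /\ Q' (successes s' t)] in
  measurable B /\
  P B = (bernoulli_mean p s (fun b => `[< Q b >]%:R) *
         bernoulli_mean p s' (fun b => `[< Q' b >]%:R))%:E.
Proof.
move=> uss' ss'D B.
have split_blocks b b' : subseq b s -> subseq b' s' ->
    [seq i <- b ++ b' | i \in s] = b /\ [seq i <- b ++ b' | i \in s'] = b'.
  move=> /mem_subseq bs /mem_subseq bs'; rewrite !filter_cat.
  move: uss'; rewrite cat_uniq => /and3P[_ /hasPn dis _].
  have -> : [seq i <- b | i \in s] = b by apply/all_filterP/allP.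
  have -> : [seq i <- b' | i \in s'] = b' by apply/all_filterP/allP.
  have -> : [seq i <- b' | i \in s] = [::].
    apply/eqP; rewrite -[_ == _]negbK -has_filter; apply/hasPn => i /bs'.
    exact: dis.
  have -> : [seq i <- b | i \in s'] = [::].
    apply/eqP; rewrite -[_ == _]negbK -has_filter; apply/hasPn => i /bs ibs.
    by apply/negP => /dis; rewrite ibs.
  by rewrite cats0.
pose QQ b := Q [seq i <- b | i \in s] /\ Q' [seq i <- b | i \in s'].
have -> : B = [set t | QQ (successes (s ++ s') t)].
  apply/funext => t; rewrite /B /QQ /= /successes filter_cat -/(successes _ _).
  have [E E'] := split_blocks _ _ (filter_subseq (fun i => `[< A i t >]) s)
    (filter_subseq (fun i => `[< A i t >]) s').
  by rewrite E E'.
have [mQ ->] := successes_prob QQ uss' ss'D; split=> //; congr EFin.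
rewrite bernoulli_mean_cat -bernoulli_meanZr; apply: eq_bernoulli_mean => // b bs.
rewrite -bernoulli_meanZl; apply: eq_bernoulli_mean => // b' bs'.
by rewrite /QQ; have [-> ->] := split_blocks _ _ bs bs'; rewrite asbool_and -natrM mulnb.
Qed.

End BernoulliLaw.

(** The sequence is shifted by [n0], so that the bounds hold from index 0 on and the probabilities
    sum to at most [(1 - z)^-1]. The exceptional null set is the limsup of the shifted events. *)
Lemma geometric_borel_cantelli (R : realType) d (T : measurableType d)
    (P : probability T R) (F : nat -> set T) (z : R) (n0 : nat) :
  0 < z < 1 -> (forall n, (n0 <= n)%N -> measurable (F n)) ->
  (forall n, (n0 <= n)%N -> (P (F n) <= (z ^+ n)%:E)%E) ->
  {ae P, forall t, exists m, forall n, (m <= n)%N -> ~ F n t}.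
Proof.
move=> /andP[z0 z1] mF PF; pose F' n := F (n + n0)%N.
have mF' n : measurable (F' n) by apply: mF; exact: leq_addl.
exists (lim_sup_set F'); split.
- by apply: bigcapT_measurable => n; apply: bigcup_measurable.
- apply: lim_sup_set_cvg0 => //; apply: (@le_lt_trans _ _ ((1 - z)^-1)%:E); last exact: ltry.
  apply: lime_le; first by apply: is_cvg_nneseries => n _ _; exact: measure_ge0.
  apply: nearW => n; apply: (@le_trans _ _ (\sum_(0 <= i < n) (z ^+ i)%:E)%E).
    apply: lee_sum => i _; apply: (le_trans (PF _ (leq_addl _ _))).
    by rewrite lee_fin; apply: ler_wiXn2l; rewrite ?leq_addr// ltW.
  rewrite sumEFin lee_fin exprn_geometric.
  have := @geometric_le_lim R n 1 z ler01 z0; rewrite (ger0_norm (ltW z0)) => /(_ z1).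
  by rewrite mul1r.
- move=> t /= ninf n _; apply: contrapT => nF; apply: ninf.
  exists (n + n0)%N => k nk; have k0 := leq_trans (leq_addl _ _) nk.
  rewrite -(subnK k0) => Fk; apply: nF; exists (k - n0)%N => //=.
  by rewrite leq_subRL// addnC.
Qed.

(** * The anchored inequality as a bound with an explicit constant *)

Section AnchoredIP.
Variables (R : realType) (V : choiceType) (H : sgraph V) (o : V) (psi : R -> R).
Hypothesis psi_gt0 : forall x : R, 0 < x -> 0 < psi x.

Lemma set_card_gt0 (A : set V) x : finite_set A -> A x -> (0 < set_card A)%N.
Proof.
move=> finA Ax; rewrite cardfs_gt0; apply/fset0Pn; exists x.
by rewrite in_fset_set// inE.
Qed.

Lemma le_set_card (T : choiceType) (A B : set T) :
  A `<=` B -> finite_set B -> (set_card A <= set_card B)%N.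
Proof.
move=> AB finB; apply: fsubset_leq_card; apply/fsubsetP => x.
by rewrite !in_fset_set ?inE//; [exact: AB|exact: sub_finite_set finB].
Qed.

Let ratio_inf n := ereal_inf
    [set ((set_card (edge_boundary H S))%:R / psi (set_card S)%:R)%:E
       | S in anchored_sets H o n].

Let ratio_inf_nd : {homo ratio_inf : n m / (n <= m)%N >-> (n <= m)%E}.
Proof.
move=> n m nm; apply: ereal_inf_le_tmp => _ [S [So conS finS mS] <-].
by exists S => //; split=> //; exact: leq_trans mS.
Qed.

(** The infima are nondecreasing in [n], so their limit is their supremum, which is positive exactly
    when one of them is. *)
Lemma anchored_IPP : anchored_IP H o psi <->
  exists c : R, 0 < c /\ exists N, forall S, anchored_sets H o N S ->
    c * psi (set_card S)%:R <= (set_card (edge_boundary H S))%:R.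
Proof.
have psiS N S : anchored_sets H o N S -> 0 < psi (set_card S)%:R.
  by case=> So _ finS _; apply: psi_gt0; rewrite ltr0n; exact: set_card_gt0 So.
have limE : anchored_constant H o psi = ereal_sup (range ratio_inf).
  by apply/cvg_lim => //; exact: ereal_nondecreasing_cvgn.
rewrite /anchored_IP limE; split=> [|[c [c0 [N cN]]]]; last first.
  apply: (@lt_le_trans _ _ c%:E); first by rewrite lte_fin.
  apply: le_trans (ereal_sup_ubound _); last by exists N.
  apply/ereal_infP => _ [S NS <-]; rewrite lee_fin ler_pdivlMr ?cN//.
  exact: psiS NS.
move=> /ereal_sup_gt[_ [N _ <-]] N0.
have [c c0 cN] : exists2 c : R, 0 < c & (c%:E <= ratio_inf N)%E.
  move: N0; case: (ratio_inf N) => [r||] //.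
    by rewrite lte_fin => r0; exists r.
  (* An infinite infimum occurs when no anchored set is large enough; any positive constant then
     serves. *)
  by move=> _; exists 1 => //; rewrite leey.
exists c; split=> //; exists N => S NS.
rewrite -ler_pdivlMr; last exact: psiS NS.
by rewrite -lee_fin; move/ereal_infP: cN; apply; exists S.
Qed.

End AnchoredIP.

(** * Sets with few open frontier edges *)

(** The last inequality says that the Chernoff factor per edge, [(p * u ^+ k + (1 - p)) / u],
    exceeds the probability [1 - p] of a closed edge by a factor of at most [theta]. With
    [u = rho + 2 * eps] and [theta = (1 + eps) / u], [theta * rho < 1] reduces to
    [rho * eps < 2 * eps]; [k] is then taken so large that [u ^+ k < eps * (1 - p)]. *)
Lemma chernoff_parameters (R : realType) (p rho : R) :
  0 <= p < 1 -> 0 <= rho < 1 -> exists k : nat, exists u theta : R,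
  [/\ 0 < u <= 1, 0 <= theta, theta * rho < 1 &
      p * u ^+ k + (1 - p) <= u * (theta * (1 - p))].
Proof.
move=> /andP[p0 p1] /andP[rho0 rho1].
pose u := (1 + rho) / 2; pose eps := (u - rho) / 2.
have u0 : 0 < u by rewrite /u; lra.
have u1 : u < 1 by rewrite /u; lra.
have eps0 : 0 < eps by rewrite /eps /u; lra.
have [k _ uk] : \forall k \near \oo, `|u ^+ k| < eps * (1 - p).
  have absu : `|u| < 1 by rewrite ger0_norm// ltW.
  have /cvgr0Pnorm_lt := cvg_expr absu; apply.
  by rewrite mulr_gt0// subr_gt0.
exists k, u, ((1 + eps) / u); split.
- by rewrite u0 ltW.
- by rewrite divr_ge0 ?addr_ge0 ?(ltW u0) ?(ltW eps0).
- rewrite mulrAC ltr_pdivrMr// mul1r /eps.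
  have : rho * u <= u by rewrite ler_piMl ?(ltW u0) ?(ltW rho1).
  have : rho * rho <= rho by rewrite ler_piMl ?(ltW rho1).
  rewrite /u; nra.
- have -> : u * ((1 + eps) / u * (1 - p)) = eps * (1 - p) + (1 - p).
    by field; exact: lt0r_neq0.
  rewrite lerD2r; apply: ltW; apply: le_lt_trans (uk k (leqnn k)).
  rewrite ger0_norm; last by rewrite exprn_ge0// ltW.
  by rewrite ler_piMl ?exprn_ge0 ?ltW.
Qed.

Section Percolation.
Context (R : realType) (V : choiceType) (G : sgraph V) (o : V).
Context (d : measure_display) (T : measurableType d).
Variables (P : probability T R) (w : T -> set (set V)) (p : R).
Hypothesis conG : connected_graph G.
Hypothesis lfG : locally_finite G.
Hypothesis Go : verts G o.
Hypothesis p01 : 0 <= p <= 1.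
Hypothesis perc : bernoulli_percolation G p P w.
Implicit Types (K S : set V) (t : T).

Definition open_edges (E : set (set V)) t : seq (set V) :=
  successes (fun e => [set t | w t e]) (fset_set E) t.

Lemma open_edgesE (E : set (set V)) t : finite_set E ->
  [set` open_edges E t] = E `&` w t.
Proof.
move=> finE; apply/seteqP; split=> e; rewrite /= mem_filter in_fset_set//.
  by move=> /andP[/asboolP we]; rewrite inE.
by move=> [Ee we]; apply/andP; split; [exact/asboolP|rewrite inE].
Qed.

(** Some open connected set, not the whole cluster, is asked to have closure [K]: this keeps the
    event independent of the edges leaving [K]. *)
Definition spans K (om : set (set V)) :=
  exists S, [/\ S o, connected_in (open_graph G om) S & filled_closure G S = K].

(** A set with closure [K] is contained in [K], so its open connectedness involves only edges inside
    [K]. *)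
Lemma spans_local K t : finite_set K ->
  spans K (w t) <-> spans K [set` open_edges (inner_edges G K) t].
Proof.
move=> finK; rewrite open_edgesE; last exact: inner_edges_finite.
have inner S : filled_closure G S = K -> inner_edges G S `<=` inner_edges G K.
  move=> SK _ [x [y [xy Sx Sy ->]]]; exists x, y; split=> //; rewrite -SK;
  exact: sub_filled_closure.
split=> -[S [So conS SK]]; exists S; split=> //;
  apply: connected_in_open_graph_eq conS => e.
  by move=> /(inner _ SK).
by move=> _ [].
Qed.

Definition span_weight K : R :=
  bernoulli_mean p (fset_set (inner_edges G K)) (fun b => `[< spans K [set` b] >]%:R).

Lemma spans_block_prob K (Q : seq (set V) -> Prop) : finite_set K ->
  let B := [set t | spans K (w t) /\ Q (open_edges (edge_boundary G K) t)] in
  measurable B /\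
  P B = (span_weight K *
    bernoulli_mean p (fset_set (edge_boundary G K)) (fun b => `[< Q b >]%:R))%:E.
Proof.
move=> finK B; case: perc => mw Pw indw.
have finE := inner_edges_finite G finK.
have finF := edge_boundary_finite lfG finK.
have -> : B = [set t | spans K [set` open_edges (inner_edges G K) t] /\
    Q (open_edges (edge_boundary G K) t)].
  by apply/funext => t; rewrite /B /= (propext (spans_local t finK)).
apply: (successes_block_prob mw Pw p01 indw (fun b => spans K [set` b]) Q).
  rewrite cat_uniq !fset_uniq andbT /=; apply/hasPn => e.
  rewrite !in_fset_set// inE => Fe; apply/negP; rewrite inE => Ee.
  by have : set0 e by rewrite -(inner_edges_boundary_disjoint G K); split.
move=> e; rewrite mem_cat !in_fset_set// => /orP[]; rewrite inE.
  exact: inner_edges_edges.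
exact: edge_boundary_edges.
Qed.

Definition isolated K : set T :=
  [set t | spans K (w t) /\ size (open_edges (edge_boundary G K) t) = 0%N].

Definition deficient k K : set T :=
  [set t | spans K (w t) /\ (k * size (open_edges (edge_boundary G K) t)
                             <= set_card (edge_boundary G K))%N].

Lemma isolated_prob K : finite_set K -> measurable (isolated K) /\
  P (isolated K) = (span_weight K * (1 - p) ^+ set_card (edge_boundary G K))%:E.
Proof.
move=> finK; have [m E] := spans_block_prob (fun b => size b = 0%N) finK.
split=> //; rewrite [LHS]E -bernoulli_mean_none; congr (_ * bernoulli_mean _ _ _)%:E.
by apply/funext => b; congr (nat_of_bool _)%:R; apply/asboolP/eqP.
Qed.

Lemma deficient_measurable k K : finite_set K -> measurable (deficient k K).
Proof.
move=> finK.
by have [] := spans_block_prob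
  (fun b => (k * size b <= set_card (edge_boundary G K))%N) finK.
Qed.

(** Both probabilities carry the same factor [span_weight K], so only the boundary factors are
    compared: a Chernoff bound against [(1 - p) ^+ n], where [n] is the boundary size. *)
Lemma deficient_prob (rho : R) : 0 <= rho < 1 ->
  exists k (theta : R), [/\ (0 < k)%N, 0 <= theta, theta * rho < 1 &
  forall K, finite_set K -> (0 < set_card (edge_boundary G K))%N ->
  (P (deficient k K) <=
     (theta ^+ set_card (edge_boundary G K))%:E * P (isolated K))%E].
Proof.
move=> rho01; have /andP[rho0 rho1] := rho01; have /andP[p0 p1] := p01.
have defE k K : finite_set K -> P (deficient k K) = (span_weight K *
    bernoulli_mean p (fset_set (edge_boundary G K))
      (fun b => (k * size b <= set_card (edge_boundary G K))%N%:R))%:E.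
  move=> finK; have [_ E] := spans_block_prob
    (fun b => (k * size b <= set_card (edge_boundary G K))%N) finK.
  rewrite [LHS]E; congr (_ * bernoulli_mean _ _ _)%:E.
  by apply/funext => b; rewrite asboolb.
have weight0 K : 0 <= span_weight K by apply: bernoulli_mean_ge0.
have [p_lt1|p_ge1] := ltP p 1; last first.
  (* For [p = 1] the isolated event with nonempty boundary has probability 0, so the deficient one
     must too: all [n > 0] boundary edges are open and [2 * n <= n] fails. *)
  have pE : p = 1 by apply/eqP; rewrite eq_le p1.
  exists 2, 1; split=> // [|K finK F0]; first by rewrite mul1r.
  rewrite defE// pE bernoulli_mean_all leqNgt ltn_Pmull// mulr0.
  by rewrite mule_ge0// lee_fin exprn_ge0.
have [k [u [theta [u01 theta0 thr bound]]]] :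
    exists k : nat, exists u theta : R,
    [/\ 0 < u <= 1, 0 <= theta, theta * rho < 1 &
        p * u ^+ k + (1 - p) <= u * (theta * (1 - p))].
  by apply: chernoff_parameters => //; rewrite p0.
have /andP[u0 u1] := u01.
(* The successor makes the divisor positive; the bound survives because [u <= 1]. *)
exists k.+1, theta; split=> // K finK F0.
rewrite defE// (isolated_prob finK).2 -EFinM lee_fin mulrCA -exprMn.
apply: ler_wpM2l => //.
apply: le_trans (bernoulli_mean_chernoff p01 _ _ _ u01) _.
rewrite ler_pdivrMl ?exprn_gt0// -exprMn; apply: lerXn2r.
- by rewrite nnegrE addr_ge0 ?subr_ge0// mulr_ge0// exprn_ge0// ltW.
- by rewrite nnegrE !mulr_ge0 ?subr_ge0// ltW.
apply: le_trans bound; rewrite lerD2r ler_wpM2l// exprS ler_piMl//.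
by rewrite exprn_ge0// ltW.
Qed.

Definition frontier_family n : set (set V) :=
  [set K | [/\ K o, connected_in G K, finite_set K
             & set_card (edge_boundary G K) = n]].

Local Notation cluster t := (verts (open_cluster G (w t) o)).

(** The closed boundary confines the cluster to [K], while the cluster contains the open set whose
    closure is [K]; the sandwich property concludes. In particular the cluster determines [K]. *)
Lemma isolated_cluster K t : K o -> finite_set K -> isolated K t ->
  cluster t `<=` K /\ filled_closure G (cluster t) = K.
Proof.
move=> Ko finK [[S [So conS SK]] /size0nil closedF].
have CK : cluster t `<=` K.
  apply: (@cluster_sub_closed_boundary _ _ _ _ K) => // e Fe we.
  have := open_edgesE t (edge_boundary_finite lfG finK); rewrite closedF.
  by move/seteqP => -[_ /(_ e (conj Fe we))].
split=> //; rewrite -SK; apply: filled_closure_sandwich; last by rewrite SK.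
exact: open_connected_sub_cluster.
Qed.

(** A finite cluster spans its own filled closure, whose boundary is closed since an open edge
    across it would enlarge the cluster. This writes the event of the hypothesis as a union of
    isolated events. *)
Lemma finite_cluster_event n :
  [set t | finite_set (cluster t) /\
           set_card (edge_frontier G (cluster t)) = n] =
  \bigcup_(K in frontier_family n) isolated K.
Proof.
apply/seteqP; split=> t.
  move=> [finC Cn]; have Co := cluster_center (w t) Go.
  have conC := cluster_connected (w t) Go.
  have conGC := open_connected_in conC.
  have finK := filled_closure_finite conG lfG Co (@cluster_verts _ G (w t) o) finC.
  exists (filled_closure G (cluster t)).
    split=> //; first exact: sub_filled_closure.
    exact: filled_closure_connected Co conGC.
  split; first by exists (cluster t).
  apply/eqP; rewrite -leqn0 leqNgt -has_predT; apply/hasP => -[e eF _].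
  have : [set` open_edges (edge_boundary G (filled_closure G (cluster t))) t] e by [].
  rewrite open_edgesE; last exact: edge_boundary_finite.
  by move=> [] /frontier_cluster_closed.
move=> [K [Ko conK finK Kn] isoK].
have [CK CKE] := isolated_cluster Ko finK isoK.
by split; [exact: sub_finite_set CK finK|rewrite /edge_frontier CKE].
Qed.

Lemma deficient_union_prob k n (theta q : R) :
  finite_set (frontier_family n) -> 0 <= theta ->
  (forall K, frontier_family n K ->
     (P (deficient k K) <= (theta ^+ n)%:E * P (isolated K))%E) ->
  (P [set t | finite_set (cluster t) /\
              set_card (edge_frontier G (cluster t)) = n] <= (q ^+ n)%:E)%E ->
  (P (\bigcup_(K in frontier_family n) deficient k K)
     <= ((theta * q) ^+ n)%:E)%E.
Proof.
move=> finF theta0 defK.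
have famfin K : frontier_family n K -> finite_set K by case.
rewrite finite_cluster_event measure_fin_bigcup//; first last.
- by move=> K /famfin/isolated_prob[].
(* Disjointness: two sets isolated at the same outcome are both the filled closure of the
   cluster. *)
- move=> K K' [Ko _ finK _] [K'o _ finK' _] [t [isoK isoK']].
  by rewrite -(isolated_cluster Ko finK isoK).2 (isolated_cluster K'o finK' isoK').2.
(* A union bound for the deficient events; by comparison their sum is at most [theta ^+ n] times the
   sum over isolated events, which the hypothesis bounds. *)
move=> sumle; apply: (@le_trans _ _ (\sum_(K \in frontier_family n) P (deficient k K))%E).
  apply: content_sub_fsum => // [K /famfin|]; first exact: deficient_measurable.
  by apply: fin_bigcup_measurable => // K /famfin; exact: deficient_measurable.
apply: le_trans (lee_fsum finF defK) _.
rewrite -ge0_mule_fsumr; last by move=> K; exact: measure_ge0.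
by rewrite exprMn EFinM; apply: lee_wpmul2l => //; rewrite lee_fin exprn_ge0.
Qed.

End Percolation.

(** * Finiteness of the frontier families, and the conclusion *)

Lemma cvgy_nat_ge (R : realType) (psi : R -> R) (a : R) :
  psi x @[x --> +oo] --> +oo ->
  exists M : nat, forall m : nat, (M <= m)%N -> a <= psi m%:R.
Proof.
move=> /cvgryPge/(_ a)[M [_ psiM]].
have [m Mm] : exists m : nat, M < m%:R.
  exists (Num.truncn M).+1; exact: truncnS_gt.
exists m => k mk; apply: psiM; apply: lt_le_trans Mm _.
by rewrite ler_nat.
Qed.

Lemma frontier_family_finite (R : realType) (V : choiceType) (G : sgraph V)
    (o : V) (psi : R -> R) n : locally_finite G ->
  (forall x : R, 0 < x -> 0 < psi x) -> psi x @[x --> +oo] --> +oo ->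
  anchored_IP G o psi -> finite_set (frontier_family G o n).
Proof.
move=> lfG psi_gt0 psi_oo /(anchored_IPP _ _ psi_gt0)[c [c0 [N cN]]].
(* Beyond size [maxn N M] the anchored inequality would force at least [n.+1] boundary edges, so the
   members of the family have bounded size. *)
have [M psiM] := cvgy_nat_ge (n.+1%:R / c) psi_oo.
apply: sub_finite_set (finite_connected_sets o (maxn N M) lfG).
move=> K [Ko conK finK Kn]; split=> //; rewrite leqNgt; apply/negP.
rewrite gtn_max => /andP[NK MK].
have := cN K; rewrite Kn => /(_ _)/le_trans.
have := psiM _ (ltnW MK); rewrite ler_pdivrMr// mulrC => le1 le2.
have : n.+1%:R <= n%:R :> R.
  by apply: le_trans le1 _; apply: le2; [split=> //; exact: ltnW|].
by rewrite ler_nat ltnn.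
Qed.

Lemma open_cluster_locally_finite (V : choiceType) (G : sgraph V)
    (w : set (set V)) (o : V) :
  locally_finite G -> locally_finite (open_cluster G w o).
Proof. by move=> lfG x; apply: sub_finite_set (lfG x) => y [[]]. Qed.

Theorem theorem1p5 (R : realType) (V : choiceType) (G : sgraph V) (o : V)
    (psi : R -> R) (p rho : R) (d : measure_display) (T : measurableType d)
    (P : probability T R) (w : T -> set (set V)) :
  connected_graph G -> bounded_degree G -> infinite_graph G -> verts G o ->
  (forall x : R, 0 < x -> 0 < psi x) ->
  (forall x y : R, 0 < x -> x <= y -> psi x <= psi y) ->
  psi x @[x --> +oo] --> +oo ->
  anchored_IP G o psi ->
  0 <= p <= 1 ->
  bernoulli_percolation G p P w ->
  rho < 1 ->
  (\forall n \near \oo,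
     (P [set t | finite_set (verts (open_cluster G (w t) o)) /\
                 set_card (edge_frontier G (verts (open_cluster G (w t) o))) = n]
        <= (rho ^+ n)%:E)%E) ->
  {ae P, forall t, infinite_graph (open_cluster G (w t) o) ->
                   anchored_IP (open_cluster G (w t) o) o psi}.
Proof.
move=> conG degG _ Go psi_gt0 psi_nd psi_oo ipG p01 perc rho1 [N _ tail].
have lfG := bounded_degree_locally_finite degG.
(* A probability is at most [rho] to an odd power beyond the threshold, which rules out negative
   [rho]. *)
have rho0 : 0 <= rho.
  have odd2 : odd N.*2.+1 by rewrite /= odd_double.
  rewrite -(exprn_odd_ge0 _ odd2) -lee_fin; apply: le_trans (tail N.*2.+1 _).
    exact: measure_ge0.
  by rewrite /= -addnn -addnS leq_addr.
have rho01 : 0 <= rho < 1 by rewrite rho0.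
have [k [theta [k0 theta0 thr defP]]] := deficient_prob o lfG p01 perc rho01.
have finF n := frontier_family_finite n lfG psi_gt0 psi_oo ipG.
pose bad n := \bigcup_(K in frontier_family G o n) deficient G o w k K.
(* The midpoint of [theta * rho] and 1 is a positive ratio even when [theta * rho] vanishes. *)
pose z := (1 + theta * rho) / 2.
have thr0 : 0 <= theta * rho by exact: mulr_ge0.
have z01 : 0 < z < 1 by rewrite /z; apply/andP; split; lra.
have bad_meas n : measurable (bad n).
  apply: fin_bigcup_measurable => // K [_ _ finK _].
  exact: (deficient_measurable _ lfG p01 perc).
(* The comparison of deficient with isolated events requires a nonempty boundary, hence [n >= 1]. *)
have bad_prob n : (maxn N 1 <= n)%N -> (P (bad n) <= (z ^+ n)%:E)%E.
  rewrite geq_max => /andP[Nn n0].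
  apply: (@le_trans _ _ ((theta * rho) ^+ n)%:E).
    apply: (deficient_union_prob conG lfG Go p01 perc (finF n) theta0) (tail n Nn).
    by move=> K [_ _ finK Kn]; rewrite -Kn; apply: defP; rewrite // Kn.
  rewrite lee_fin; apply: lerXn2r; rewrite ?nnegrE//; first by case/andP: z01 => /ltW.
  by rewrite /z; lra.
have := geometric_borel_cantelli z01 (fun n _ => bad_meas n) bad_prob.
apply: filterS => t [m good] _.
have /(anchored_IPP _ _ psi_gt0)[c [c0 [N1 cN1]]] := ipG.
(* Sets of size at least [M] will have frontiers of at least [m] edges, a range in which no bad
   event occurs at [t]. *)
have [M psiM] := cvgy_nat_ge (m%:R / c) psi_oo.
apply/(anchored_IPP _ _ psi_gt0); exists (c / k%:R); split.
  by rewrite divr_gt0// ltr0n.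
exists (maxn N1 M) => S [So /cluster_connected_open conS finS].
rewrite geq_max => /andP[N1S MS].
have conGS := open_connected_in conS.
pose K := filled_closure G S.
have Ko : K o by exact: sub_filled_closure.
have finK : finite_set K by apply: filled_closure_finite So conGS.1 finS.
have conK : connected_in G K by exact: filled_closure_connected So conGS.
have SK : (set_card S <= set_card K)%N.
  by apply: le_set_card finK; exact: sub_filled_closure.
have S0 : 0 < (set_card S)%:R :> R by rewrite ltr0n; exact: set_card_gt0 So.
(* The inequality of [G] is applied to the filled closure, and monotonicity of [psi] passes from the
   size of [K] down to that of [S]. *)
have psiSK : c * psi (set_card S)%:R <= (set_card (edge_boundary G K))%:R.
  apply: (@le_trans _ _ (c * psi (set_card K)%:R)).
    by rewrite ler_pM2l//; apply: psi_nd; rewrite // ler_nat.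
  by apply: cN1; split=> //; exact: leq_trans SK.
have mK : (m <= set_card (edge_boundary G K))%N.
  rewrite -(ler_nat R); apply: le_trans psiSK.
  by rewrite mulrC -ler_pdivrMr//; exact: psiM.
(* Otherwise [K], spanned by [S], would witness the bad event indexed by its boundary size. *)
have many_open : (set_card (edge_boundary G K) <
    k * size (open_edges w (edge_boundary G K) t))%N.
  rewrite ltnNge; apply/negP => few; apply: good mK _.
  by exists K => //; split=> //; exists S.
have open_bound : (size (open_edges w (edge_boundary G K) t) <=
    set_card (edge_boundary (open_cluster G (w t) o) S))%N.
  have finB : finite_set (edge_boundary (open_cluster G (w t) o) S).
    by apply: edge_boundary_finite finS; exact: open_cluster_locally_finite.
  have finBK := edge_boundary_finite lfG finK.
  apply: uniq_leq_size => [|e eF]; first by rewrite filter_uniq// fset_uniq.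
  rewrite in_fset_set// inE.
  apply: open_frontier_sub_boundary; first exact: open_connected_sub_cluster.
  by rewrite -(open_edgesE w t finBK).
rewrite mulrAC ler_pdivrMr ?ltr0n//; apply: le_trans psiSK _.
rewrite -natrM ler_nat; apply: leq_trans (ltnW many_open) _.
by rewrite mulnC leq_mul2r open_bound orbT.
Qed.
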